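(* The reward design problem admits at least one optimal interior-point allocation if and only if the optimal value of the problem $$\text{maximize } \ C-\sum_{i=1}^{|\mathcal S_d|}x_i\quad\text{over } x\in\mathcal X,\ m\in\mathcal M\quad\text{subject to } \langle r_1,m\rangle=v_1^\star,\ \ m\in\mathsf{BR}(x)$$ is strictly positive.
   Context: Setting. The follower faces a Markov decision process with finite state space $\mathcal S$, finite action space $\mathcal A$, transition kernel $\mathcal T:\mathcal S\times\mathcal A\times\mathcal S\to[0,1]$ ($\mathcal T(s,a,s')$ is the probability of moving from $s$ to $s'$ under action $a$), reward function $r:\mathcal S\times\mathcal A\to\mathbb R$, discount factor $\gamma\in(0,1]$, and initial distribution $\rho$ on $\mathcal S$. A policy is $\pi:\mathcal S\times\mathcal A\to[0,1]$ such that $\pi(s,\cdot)$ is a probability distribution on $\mathcal A$ for every $s$. The occupancy measure induced by $\pi$ is $m(s,a)=\mathbb E_{\pi,s_0\sim\rho}\big[\sum_{t=0}^\infty\gamma^t\,\mathbb P(s_t=s,a_t=a)\big]$. The set of valid occupancy measures is $\mathcal M=\{m\in\mathbb R^{\mathcal S\times\mathcal A}: m\ge0,\ \sum_{a}m(s,a)=\rho(s)+\gamma\sum_{s',a'}\mathcal T(s',a',s)m(s',a')\ \forall s\in\mathcal S\}$. For $f\in\mathbb R^{\mathcal S\times\mathcal A}$, $\langle f,m\rangle=\sum_{(s,a)\in\mathcal S\times\mathcal A}f(s,a)m(s,a)$. $\mathcal S_d=\{s_1,\dots,s_K\}\subseteq\mathcal S$ is the set of states at which the leader can allocate reward. A reward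 allocation is a function $x:\mathcal S_d\to\mathbb R$, identified with the vector in $\mathbb R^{|\mathcal S_d|}$ with entries $x_i=x(s_i)$. For a given budget $C$, the set of admissible allocations is $\mathcal X=\{x: x\ge0,\ \sum_{i=1}^{|\mathcal S_d|}x_i\le C\}$. The follower's modified reward is $r_2^x(s,a)=r(s,a)+x(s)$ for $s\in\mathcal S_d$ and $r_2^x(s,a)=r(s,a)$ for $s\notin\mathcal S_d$. The leader's reward is $r_1(s,a)=1$ if $s\in\mathcal S_d$ and $r_1(s,a)=0$ otherwise. The set of best responses of the follower is $\mathsf{BR}(x)=\arg\max_{m\in\mathcal M}\langle r_2^x,m\rangle$. The reward design problem is: maximize $\langle r_1,m\rangle$ over $x\in\mathcal X$, $m\in\mathcal M$ subject to $m\in\mathsf{BR}(x)$. Its optimal value is $v_1^\star$; if $(x^\star,m^\star)$ is an optimal solution, $x^\star$ is called an optimal allocation and $m^\star$ an optimal occupancy measure. The allocation region of $m\in\mathcal M$ is $\mathcal P_m=\{x\in\mathbb R^{|\mathcal S_d|}: m\in\mathsf{BR}(x)\}$; the allocation region of an optimal occupancy measure is called an optimal allocation region. An allocation $x\in\mathcal X$ is an interior-point allocation of $\mathcal P_m$ if there exists $c>0$ such that $x+cv\in\mathcal P_m$ for all $v\in\mathbb R^{|\mathcal S_d|}$ with $\|v\|_1\le1$. An optimal interior-point allocation is an interior-point allocation of an optimal allocation region.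
   Formalization: The formal statement assumes the budget C is nonzero; for C = 0 the claim fails (one state, one action, discount below 1: x = 0 is an optimal interior-point allocation, but the second problem has value 0). *)

(* Defs.v *)
From HB Require Import structures.
From mathcomp Require Import all_boot all_order all_algebra.
From mathcomp Require Import all_classical all_reals ereal.

Set Implicit Arguments.
Unset Strict Implicit.
Unset Printing Implicit Defensive.

Import Order.TTheory GRing.Theory Num.Theory.

Local Open Scope classical_set_scope.
Local Open Scope ring_scope.

Record mdp (R : realType) (S A : finType) := MDP {
  trans : S -> A -> S -> R;
  reward : S -> A -> R;
  discount : R;
  init : S -> R;
  trans_ge0 : forall s a s', 0 <= trans s a s';
  trans_sum1 : forall s a, \sum_(s' : S) trans s a s' = 1;
  discount_gt0 : 0 < discount;
  discount_le1 : discount <= 1;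
  init_ge0 : forall s, 0 <= init s;
  init_sum1 : \sum_(s : S) init s = 1 }.

Definition pairing (R : realType) (S A : finType) (f m : S -> A -> R) : R :=
  \sum_(p : S * A) f p.1 p.2 * m p.1 p.2.

(* For discount 1 this set is empty: summing the flow equations over the
   states gives [sum m = 1 + sum m]. *)
Definition occupancy (R : realType) (S A : finType) (M : mdp R S A)
    : set (S -> A -> R) :=
  [set m | (forall s a, 0 <= m s a) /\
    (forall s, \sum_(a : A) m s a =
       init M s +
       discount M * \sum_(p : S * A) trans M p.1 p.2 s * m p.1 p.2)].

Definition allocation (R : realType) (S : finType) (Sd : {set S}) :=
  {s : S | s \in Sd} -> R.

Definition admissible (R : realType) (S : finType) (Sd : {set S}) (C : R)
    : set (allocation R Sd) :=
  [set x | (forall i, 0 <= x i) /\ \sum_i x i <= C].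

(* [insub s] is [Some i] with [val i = s] if [s \in Sd], and [None] otherwise. *)
Definition follower_reward (R : realType) (S A : finType) (M : mdp R S A)
    (Sd : {set S}) (x : allocation R Sd) (s : S) (a : A) : R :=
  if insub s is Some i then reward M s a + x i else reward M s a.

Definition leader_reward (R : realType) (S A : finType) (Sd : {set S})
    (s : S) (a : A) : R :=
  if s \in Sd then 1 else 0.

Definition best_response (R : realType) (S A : finType) (M : mdp R S A)
    (Sd : {set S}) (x : allocation R Sd) : set (S -> A -> R) :=
  [set m | occupancy M m /\
    forall m', occupancy M m' ->
      pairing (follower_reward M x) m' <= pairing (follower_reward M x) m].

Definition leader_value (R : realType) (S A : finType) (Sd : {set S})
    (m : S -> A -> R) : R :=
  pairing (leader_reward R Sd) m.

Definition feasible (R : realType) (S A : finType) (M : mdp R S A)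
    (Sd : {set S}) (C : R) : set (allocation R Sd * (S -> A -> R)) :=
  [set z | [/\ admissible C z.1, occupancy M z.2 & best_response M z.1 z.2]].

(* Optimal values are suprema in the extended reals, [-oo] if there is no
   feasible point. *)
Definition optimal_value (R : realType) (S A : finType) (M : mdp R S A)
    (Sd : {set S}) (C : R) : \bar R :=
  ereal_sup [set (leader_value Sd z.2)%:E | z in feasible M (Sd := Sd) C].

Definition optimal_solution (R : realType) (S A : finType) (M : mdp R S A)
    (Sd : {set S}) (C : R) (x : allocation R Sd) (m : S -> A -> R) : Prop :=
  feasible M C (x, m) /\
  forall x' m', feasible M (Sd := Sd) C (x', m') ->
    leader_value Sd m' <= leader_value Sd m.

Definition optimal_occupancy (R : realType) (S A : finType) (M : mdp R S A)
    (Sd : {set S}) (C : R) (m : S -> A -> R) : Prop :=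
  exists x : allocation R Sd, optimal_solution M C x m.

(* Allocations here are arbitrary real vectors: neither nonnegativity nor the
   budget is imposed. *)
Definition allocation_region (R : realType) (S A : finType) (M : mdp R S A)
    (Sd : {set S}) (m : S -> A -> R) : set (allocation R Sd) :=
  [set x | best_response M x m].

Definition interior_point_allocation (R : realType) (S A : finType)
    (M : mdp R S A) (Sd : {set S}) (C : R) (m : S -> A -> R)
    (x : allocation R Sd) : Prop :=
  admissible C x /\
  exists2 c : R, 0 < c &
    forall v : allocation R Sd, \sum_i `|v i| <= 1 ->
      allocation_region M m (fun i => x i + c * v i).

Definition optimal_interior_point_allocation (R : realType) (S A : finType)
    (M : mdp R S A) (Sd : {set S}) (C : R) (x : allocation R Sd) : Prop :=
  exists2 m, optimal_occupancy M Sd C m & interior_point_allocation M C m x.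

Definition unused_budget_value (R : realType) (S A : finType) (M : mdp R S A)
    (Sd : {set S}) (C : R) : \bar R :=
  ereal_sup [set (C - \sum_i z.1 i)%:E | z in
    [set z : allocation R Sd * (S -> A -> R) |
      [/\ admissible C z.1, occupancy M z.2,
          (leader_value Sd z.2)%:E = optimal_value M Sd C
        & best_response M z.1 z.2]]].

(* Main.v *)
Require Import Defs.
From HB Require Import structures.
From mathcomp Require Import all_boot all_order all_algebra.
From mathcomp Require Import all_classical all_reals ereal.
From mathcomp Require Import ring lra.

(** If some optimal allocation leaves budget unused, a small uniform bonus on
    [Sd] stays within the budget and breaks the follower's ties in favour of the
    leader, so every best response to it is optimal.  The occupancy polytope has
    finitely many vertices (a vertex is determined by its support), so the
    follower's value is a maximum of finitely many affine functions of the
    allocation.  Moving slightly further, along the visit frequencies of the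
    best-responding vertex for which these have the largest Euclidean norm,
    makes that vertex optimal on a whole neighbourhood.  Conversely, an interior
    point that exhausts the budget has a positive entry (as [C != 0]), which can
    be lowered without leaving the allocation region. *)

Set Implicit Arguments.
Unset Strict Implicit.
Unset Printing Implicit Defensive.

Import Order.TTheory GRing.Theory Num.Theory.

Local Open Scope ring_scope.

(** * The occupancy polytope and its vertices *)

Lemma pairing_affine (R : realType) (S A : finType) (f m m' : S -> A -> R)
    (t : R) :
  pairing f (fun s a => m s a + t * (m' s a - m s a)) =
  pairing f m + t * (pairing f m' - pairing f m).
Proof.
rewrite /pairing -sumrB mulr_sumr -big_split /=.
by apply: eq_bigr => p _; ring.
Qed.

(** Sum the flow equations over the states. It follows that all occupancy measures have the same
    total mass, and that [discount M] is not 1 once one exists. *)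
Lemma occupancy_mass {R : realType} {S A : finType} {M : mdp R S A}
    {m : S -> A -> R} :
  occupancy M m -> (1 - discount M) * (\sum_(p : S * A) m p.1 p.2) = 1.
Proof.
case=> _ flow.
have inflow : \sum_s \sum_(p : S * A) trans M p.1 p.2 s * m p.1 p.2 =
    \sum_(p : S * A) m p.1 p.2.
  rewrite exchange_big /=; apply: eq_bigr => p _.
  by rewrite -mulr_suml trans_sum1 mul1r.
have : \sum_s \sum_a m s a = 1 + discount M * \sum_(p : S * A) m p.1 p.2.
  rewrite -{}inflow mulr_sumr -(init_sum1 M) -big_split /=.
  by apply: eq_bigr => s _.
by rewrite pair_big /= mulrBl mul1r => {1}->; rewrite addrK.
Qed.

(** [t] may lie outside [0, 1]: the line through two occupancy measures is followed beyond them, as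
    long as all entries stay nonnegative. *)
Lemma occupancy_affine (R : realType) (S A : finType) (M : mdp R S A)
    (m m' : S -> A -> R) (t : R) :
  occupancy M m -> occupancy M m' ->
  (forall s a, 0 <= m s a + t * (m' s a - m s a)) ->
  occupancy M (fun s a => m s a + t * (m' s a - m s a)).
Proof.
move=> [_ flow] [_ flow'] ge0; split=> // s.
rewrite big_split /= -mulr_sumr sumrB {}flow {}flow'.
have -> : \sum_(p : S * A) trans M p.1 p.2 s *
      (m p.1 p.2 + t * (m' p.1 p.2 - m p.1 p.2)) =
    \sum_(p : S * A) trans M p.1 p.2 s * m p.1 p.2 +
    t * (\sum_(p : S * A) trans M p.1 p.2 s * m' p.1 p.2 -
         \sum_(p : S * A) trans M p.1 p.2 s * m p.1 p.2).
  exact: (pairing_affine (fun s1 a1 => trans M s1 a1 s)).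
by ring.
Qed.

Definition support_set {R : realType} {S A : finType} (m : S -> A -> R) :
    {set S * A} :=
  [set p | m p.1 p.2 != 0].

(** Extreme points in the form of basic feasible solutions, so that distinct vertices have distinct
    supports. *)
Definition vertex {R : realType} {S A : finType} (M : mdp R S A)
    (m : S -> A -> R) : Prop :=
  occupancy M m /\
  forall m', occupancy M m' ->
    (support_set m' \subset support_set m)%SET -> m' = m.

(** Follow the line through [m] and [m'], in the sense that does not decrease the objective, until a
    first entry vanishes. *)
Lemma support_reduction (R : realType) (S A : finType) (M : mdp R S A)
    (f m m' : S -> A -> R) :
  occupancy M m -> occupancy M m' ->
  (support_set m' \subset support_set m)%SET -> m' <> m ->
  exists m'', [/\ occupancy M m'', pairing f m <= pairing f m'' &
    (support_set m'' \proper support_set m)%SET].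
Proof.
move=> mM m'M sub neq.
have vanish q : m q.1 q.2 = 0 -> m' q.1 q.2 = 0.
  move=> mq; apply/eqP; apply: contraT => m'q.
  by have := fintype.subsetP sub q; rewrite !inE mq eqxx => /(_ m'q).
pose sg : R := if pairing f m <= pairing f m' then 1 else -1.
have sg0 : sg != 0 by rewrite /sg; case: ifP => _; rewrite ?oppr_eq0 oner_neq0.
pose d (p : S * A) := sg * (m' p.1 p.2 - m p.1 p.2).
(* Equal masses make the entries of [d] sum to zero; being nonzero, [d] then has a negative entry,
   so the move along it is bounded. *)
have sumd : \sum_p d p = 0.
  rewrite -mulr_sumr sumrB; have := occupancy_mass mM.
  rewrite -{2}(occupancy_mass m'M) => /mulfI ->; first by rewrite subrr mulr0.
  apply/eqP => dis; have := occupancy_mass mM.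
  by rewrite dis mul0r => /eqP; rewrite eq_sym oner_eq0.
have [p0 p0lt] : exists p, d p < 0.
  apply: contrapT => nolt; apply: neq; apply/funext => s; apply/funext => a.
  have dge0 p : true -> 0 <= d p.
    by move=> _; rewrite leNgt; apply/negP => lt; apply: nolt; exists p.
  have /eqP := psumr_eq0P dge0 sumd (i := (s, a)) isT.
  by rewrite mulf_eq0 (negbTE sg0) /= subr_eq0 => /eqP.
(* Ratio test: [p] is the first entry to reach zero, and [t] the step at which it does. *)
case: (@Order.TotalTheory.arg_minP _ _ _ p0 (fun p => d p < 0)
  (fun p => m p.1 p.2 / - d p) p0lt) => p plt pmin.
have m0 q : 0 <= m q.1 q.2 by case: mM.
set t := m p.1 p.2 / - d p in pmin.
have t0 : 0 <= t by rewrite divr_ge0 ?m0 // oppr_ge0 ltW.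
have td q : t * sg * (m' q.1 q.2 - m q.1 q.2) = t * d q by rewrite mulrA.
exists (fun s a => m s a + t * sg * (m' s a - m s a)); split.
- apply: occupancy_affine => // s a; rewrite (td (s, a)).
  have [dge|dlt] := leP 0 (d (s, a)).
    by apply: addr_ge0; [exact: (m0 (s, a)) | exact: mulr_ge0].
  have := pmin _ dlt; rewrite /= ler_pdivlMr ?oppr_gt0 // => h; lra.
- rewrite pairing_affine lerDl -mulrA mulr_ge0 // /sg.
  by case: (leP (pairing f m) (pairing f m')) => h; lra.
- apply/fintype.properP; split.
    apply/fintype.subsetP => q; rewrite !inE; apply: contraNneq => mq.
    by rewrite mq vanish // subrr mulr0 addr0.
  exists p; rewrite inE.
    apply/eqP => mp; move: plt.
    by rewrite /d mp vanish // subrr mulr0 ltxx.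
  rewrite td negbK /t invrN mulrN mulNr divfK ?subrr //.
  exact: ltr0_neq0.
Qed.

Lemma exists_vertex (R : realType) (S A : finType) (M : mdp R S A)
    (f m : S -> A -> R) :
  occupancy M m -> exists2 v, vertex M v & pairing f m <= pairing f v.
Proof.
have [n] := ubnP #|support_set m|; elim: n m => // n IH m card mM.
have [mv|nv] := pselect (vertex M m); first by exists m.
have [m' [m'M sub neq]] : exists m', [/\ occupancy M m',
    (support_set m' \subset support_set m)%SET & m' <> m].
  apply: contrapT => no; apply: nv; split=> // m' m'M sub.
  by apply: contrapT => neq; apply: no; exists m'.
have [m2 [m2M le /proper_card lt]] :=
  support_reduction f mM m'M sub neq.
have [v vv le'] := IH m2 (leq_trans lt card) m2M.
by exists v => //; exact: le_trans le'.
Qed.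

Lemma finitely_many_maximizers (R : realType) (S A : finType) (M : mdp R S A)
    (m0 : S -> A -> R) :
  occupancy M m0 ->
  exists e : {set S * A} -> S -> A -> R, (forall T, occupancy M (e T)) /\
    forall f m, occupancy M m -> exists T, pairing f m <= pairing f (e T).
Proof.
move=> m0M.
(* Vertices are indexed by their supports; a set that supports no vertex gets the default [m0]. *)
have /choice[e eP] : forall T : {set S * A}, exists v, occupancy M v /\
    forall w, vertex M w -> support_set w = T -> w = v.
  move=> T.
  have [[v [vv <-]]|no] :=
      pselect (exists v, vertex M v /\ support_set v = T).
    exists v; split=> [|w [wM _] ew]; first by case: vv.
    by case: vv => _; apply=> //; rewrite ew.
  by exists m0; split=> // w wv ew; case: no; exists w.
exists e; split=> [T|f m mM]; first by case: (eP T).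
have [v vv le] := exists_vertex f mM.
by exists (support_set v); case: (eP (support_set v)) => _ /(_ v vv erefl) <-.
Qed.

Lemma small_multiple (R : realFieldType) (B G : R) :
  0 < G -> exists2 d : R, 0 < d & forall s : R, 0 < s <= d -> s * B < G.
Proof.
move=> G0; have B0 : 0 < `|B| + 1 by rewrite ltr_wpDl.
exists (G / (`|B| + 1)); first exact: divr_gt0.
move=> s /andP[s0]; rewrite ler_pdivlMr // => le.
apply: lt_le_trans le; rewrite ltr_pM2l //.
by apply: le_lt_trans (ler_norm B) _; rewrite ltrDl.
Qed.

Lemma common_bound (R : realFieldType) (I : finType) (P : I -> R -> Prop) :
  (forall i, exists2 d : R, 0 < d & forall s : R, 0 < s <= d -> P i s) ->
  exists2 d : R, 0 < d & forall s : R, 0 < s <= d -> forall i, P i s.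
Proof.
move=> ex; have /choice[d dP] : forall i, exists d, 0 < d /\
    forall s, 0 < s <= d -> P i s.
  by move=> i; have [d] := ex i; exists d.
exists (\big[Order.min/1]_i d i).
  by apply: lt_bigmin => // i _; case: (dP i).
move=> s /andP[s0 le] i; apply: (dP i).2.
by rewrite s0 (le_trans le) // bigmin_le.
Qed.

(** * Maxima of finitely many affine functions *)

Section AffineFamily.
Context {R : realType} {I J : finType} (b : I -> R) (q : I -> J -> R).

Definition affine_value (i : I) (y : J -> R) : R := b i + \sum_j y j * q i j.

Lemma affine_value_shift (i : I) (y v : J -> R) (s : R) :
  affine_value i (fun j => y j + s * v j) =
  affine_value i y + s * \sum_j v j * q i j.
Proof.
rewrite /affine_value -addrA mulr_sumr -big_split /=; congr (_ + _).
by apply: eq_bigr => j _; ring.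
Qed.

(* Among the maximizers at [y], the one whose gradient has the largest
   Euclidean norm is the strictly best one in the direction of its own
   gradient, up to ties between equal gradients (Cauchy-Schwarz). *)
Lemma robust_maximizer (y : J -> R) (i0 : I) :
  exists i, (forall k, affine_value k y <= affine_value i y) /\
    exists2 d : R, 0 < d & forall s : R, 0 < s <= d -> exists2 c : R, 0 < c &
      forall v : J -> R, \sum_j `|v j| <= 1 -> forall k,
        affine_value k (fun j => y j + s * q i j + c * v j) <=
        affine_value i (fun j => y j + s * q i j + c * v j).
Proof.
case: (@Order.TotalTheory.arg_maxP _ _ _ i0 xpredT
  (affine_value^~ y) isT) => i1 _ max1.
case: (@Order.TotalTheory.arg_maxP _ _ _ i1
  (fun i => affine_value i y == affine_value i1 y)
  (fun i => \sum_j q i j ^+ 2) (eqxx _)) => i /eqP ei maxi.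
have maxy k : affine_value k y <= affine_value i y by rewrite ei; exact: max1.
exists i; split=> //.
(* A function strictly below at [y] stays below for small [s]; one tied at [y] falls behind for
   every positive [s]. *)
have gap k : exists2 d : R, 0 < d & forall s : R, 0 < s <= d -> q k <> q i ->
    affine_value k (fun j => y j + s * q i j) <
    affine_value i (fun j => y j + s * q i j).
  set B := \sum_j q i j * q k j - \sum_j q i j * q i j.
  have [lt|ge] := ltP (affine_value k y) (affine_value i y).
    have [d d0 dP] := small_multiple B (eqbRL (subr_gt0 _ _) lt).
    exists d => // s /dP + _; rewrite /B !affine_value_shift mulrBr; lra.
  exists 1 => // s /andP[s0 _] neq.
  have eqk : affine_value k y = affine_value i y.
    by apply/eqP; rewrite eq_le maxy ge.
  rewrite !affine_value_shift eqk ltrD2l ltr_pM2l //.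
  have := maxi k; rewrite eqk ei eqxx => /(_ isT) le.
  have pos : 0 < \sum_j (q i j - q k j) ^+ 2.
    rewrite lt_neqAle sumr_ge0 ?andbT => [|j _]; last exact: sqr_ge0.
    apply/eqP => /esym/psumr_eq0P => /(_ (fun j _ => sqr_ge0 _)) z.
    apply: neq; apply/funext => j; have /eqP := z j isT.
    by rewrite sqrf_eq0 subr_eq0 => /eqP.
  have expand : \sum_j (q i j - q k j) ^+ 2 =
      \sum_j q i j ^+ 2 + \sum_j q k j ^+ 2 - 2 * \sum_j q i j * q k j.
    rewrite mulr_sumr -big_split -sumrB /=.
    by apply: eq_bigr => j _; ring.
  have sq : \sum_j q i j * q i j = \sum_j q i j ^+ 2 by [].
  by move: le pos; rewrite /= expand sq; lra.
have [d d0 dP] := common_bound gap.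
exists d => // s /dP lts.
(* Each [v j] has absolute value at most 1, so the perturbation changes the gap by at most [c] times
   the l1 distance of the gradients. *)
have small k : exists2 c : R, 0 < c & forall c' : R, 0 < c' <= c ->
    q k <> q i ->
    c' * \sum_j `|q k j - q i j| <
    affine_value i (fun j => y j + s * q i j) -
    affine_value k (fun j => y j + s * q i j).
  have [e|neq] := pselect (q k = q i); first by exists 1.
  have [c c0 cP] := small_multiple (\sum_j `|q k j - q i j|)
    (eqbRL (subr_gt0 _ _) (lts k neq)).
  by exists c => // c' /cP.
have [c c0 cP] := common_bound small.
exists c => // v v1 k.
(* With equal gradients the difference of the two values is constant, so the comparison at [y]
   carries over. *)
have [e|neq] := pselect (q k = q i).
  have := maxy k; rewrite /affine_value e !lerD2r //.
have := cP c; rewrite c0 lexx => /(_ isT k neq) lt.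
rewrite !(affine_value_shift _ (fun j => y j + s * q i j)).
suff : c * (\sum_j v j * q k j - \sum_j v j * q i j) <=
    c * \sum_j `|q k j - q i j| by rewrite mulrBr; lra.
rewrite ler_pM2l // -sumrB; apply: ler_sum => j _.
rewrite -mulrBr; apply: le_trans (ler_norm _) _; rewrite normrM.
apply: ler_piMl => //; apply: le_trans v1.
by rewrite (bigD1 j) //= lerDl sumr_ge0.
Qed.

End AffineFamily.

(** * Visit frequencies: the gradient of the follower's value in the allocation *)

Definition visits {R : realType} {S A : finType} {Sd : {set S}}
    (m : S -> A -> R) (i : {s : S | s \in Sd}) : R :=
  \sum_a m (val i) a.

Lemma pairing_follower_reward (R : realType) (S A : finType) (M : mdp R S A)
    (Sd : {set S}) (x : allocation R Sd) (m : S -> A -> R) :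
  pairing (follower_reward M x) m =
  pairing (reward M) m + \sum_i x i * visits m i.
Proof.
have -> : \sum_i x i * visits m i =
    \sum_s \sum_a oapp x 0 (insub s) * m s a.
  rewrite [RHS](bigID [in Sd]) /= [X in _ = _ + X]big1 ?addr0 => [|s sSd].
    rewrite (big_sub Sd); apply: eq_bigr => i _.
    by rewrite /visits mulr_sumr valK.
  by rewrite insubF ?(negbTE sSd) //= big1 // => a _; rewrite mul0r.
rewrite pair_big /pairing -big_split /=; apply: eq_bigr => p _.
rewrite -mulrDl; congr (_ * _); rewrite /follower_reward.
by case: insub => [i|] //=; rewrite addr0.
Qed.

Lemma leader_value_visits (R : realType) (S A : finType) (Sd : {set S})
    (m : S -> A -> R) :
  leader_value Sd m = \sum_(i : {s : S | s \in Sd}) visits m i.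
Proof.
rewrite /leader_value /pairing.
rewrite -(pair_big xpredT xpredT (fun s a => leader_reward R Sd s a * m s a)).
rewrite (bigID [in Sd]) /= [X in _ + X]big1 ?addr0 => [|s sSd].
  rewrite (big_sub Sd); apply: eq_bigr => i _; apply: eq_bigr => a _.
  by rewrite /leader_reward (valP i) mul1r.
by rewrite big1 // => a _; rewrite /leader_reward (negbTE sSd) mul0r.
Qed.

(** A supremum is positive exactly when some member is, which removes the extended reals from the
    rest of the argument. *)
Lemma unused_budget_gt0 (R : realType) (S A : finType) (M : mdp R S A)
    (Sd : {set S}) (C : R) :
  (0%:E < unused_budget_value M Sd C)%E <->
  exists (x : allocation R Sd) m, optimal_solution M C x m /\ \sum_i x i < C.
Proof.
split=> [/ereal_sup_gt[_ [[x m] /= [adm mM opt br] <-]]|].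
  rewrite lte_fin subr_gt0 => lt; exists x, m; split=> //; split=> // x' m' feas.
  rewrite -lee_fin opt; apply: ereal_sup_ubound; by exists (x', m').
case=> x [m [[[/= adm mM br] max] lt]].
apply: (@lt_le_trans _ _ (C - \sum_i x i)%:E); first by rewrite lte_fin subr_gt0.
apply: ereal_sup_ubound; exists (x, m) => //; split=> //=.
apply/eqP; rewrite eq_le; apply/andP; split.
  by apply: ereal_sup_ubound; exists (x, m).
by apply: ge_ereal_sup => _ [[x' m'] /max le <-]; rewrite lee_fin.
Qed.

(** * The two implications *)

Lemma interior_unused_budget (R : realType) (S A : finType) (M : mdp R S A)
    (Sd : {set S}) (C : R) (m : S -> A -> R) (x : allocation R Sd) :
  C != 0 -> interior_point_allocation M C m x ->
  exists x' : allocation R Sd,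
    [/\ admissible C x', best_response M x' m & \sum_i x' i < C].
Proof.
move=> C0 [[x0 xC] [c c0 ball]].
have [lt|ge] := ltP (\sum_i x i) C.
  exists x; split=> //.
  have := ball (fun=> 0); rewrite big1 => [/(_ ler01)|i _]; last exact: normr0.
  by under [X in allocation_region _ _ X]eq_fun => i do rewrite mulr0 addr0.
have xC' : \sum_i x i = C by apply/eqP; rewrite eq_le xC ge.
have [i xi] : exists i, 0 < x i.
  apply: contrapT => no; case/eqP: C0; rewrite -xC' big1 // => i _.
  apply/eqP; rewrite eq_le x0 andbT leNgt; apply/negP => lt.
  by apply: no; exists i.
(* [e <= c] keeps the shift inside the ball, and [e <= x i] keeps the lowered entry nonnegative. *)
pose e := Order.min c (x i).
have e0 : 0 < e by rewrite lt_min c0.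
have ec : e / c <= 1 by rewrite ler_pdivrMr // mul1r ge_min lexx.
pose v j := if j == i then - (e / c) else 0.
have sumv (f : R -> R) : f 0 = 0 -> \sum_j f (v j) = f (- (e / c)).
  move=> f0; rewrite (bigD1 i) //= /v eqxx big1 ?addr0 // => j /negbTE ->.
  exact: f0.
have cv j : c * v j = if j == i then - e else 0.
  rewrite /v; case: ifP => _; last by rewrite mulr0.
  by rewrite mulrN mulrCA divff ?mulr1 // gt_eqF.
have sumx : \sum_j (x j + c * v j) < C.
  rewrite big_split -mulr_sumr (sumv id) //= xC' mulrN mulrCA divff ?gt_eqF //.
  by rewrite mulr1 ltrBlDr ltrDl.
exists (fun j => x j + c * v j); split=> //; last first.
  apply: ball; rewrite (sumv Num.norm) ?normr0 // normrN ger0_norm //.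
  by rewrite divr_ge0 ?ltW.
split=> [j|]; last exact: ltW.
rewrite cv; case: eqP => [->|_]; last by rewrite addr0.
by rewrite subr_ge0 ge_min lexx orbT.
Qed.

Lemma unused_budget_interior (R : realType) (S A : finType) (M : mdp R S A)
    (Sd : {set S}) (C : R) (x : allocation R Sd) (m : S -> A -> R) :
  optimal_solution M C x m -> \sum_i x i < C ->
  exists x' : allocation R Sd, optimal_interior_point_allocation M C x'.
Proof.
move=> [[/= [x0 _] mM [_ br]] max] xC.
have [e [eM edom]] := finitely_many_maximizers mM.
pose q T (i : {s : S | s \in Sd}) := visits (e T) i.
have value T (y : allocation R Sd) : pairing (follower_reward M y) (e T) =
    affine_value (fun T => pairing (reward M) (e T)) q T y.
  exact: pairing_follower_reward.
have best T (y : allocation R Sd) :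
    (forall T', affine_value (fun T => pairing (reward M) (e T)) q T' y <=
       affine_value (fun T => pairing (reward M) (e T)) q T y) ->
    best_response M y (e T).
  move=> maxT; split=> // m' /(edom (follower_reward M y))[T' le].
  by apply: le_trans le _; rewrite !value.
(* Half of the slack pays for the uniform bonus, the other half for the move along the gradient. *)
have gap : 0 < (C - \sum_i x i) / 2 by rewrite divr_gt0 ?subr_gt0.
have [t t0 /(_ t)] := small_multiple #|{: {s : S | s \in Sd}}|%:R gap.
rewrite t0 lexx => /(_ isT) tC.
(* A uniform bonus turns the leader's value into a tie-breaker for the
   follower. *)
pose y i := x i + t * 1.
have y0 i : 0 <= y i by rewrite addr_ge0 // mulr1 ltW.
have sumy : \sum_i y i < (C + \sum_i x i) / 2.
  rewrite big_split /= -mulr_sumr sumr_const; move: tC; lra.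
have [T [maxT [d d0 dP]]] := robust_maximizer
  (fun T => pairing (reward M) (e T)) q y finset.set0.
have Tbest := best T y maxT.
have leader : leader_value Sd m <= leader_value Sd (e T).
  (* Adding the optimality of [m] at [x] to that of [e T] at [y] cancels all but [t] times the
     leader's values. *)
  have := br _ (eM T); have := Tbest.2 _ mM.
  rewrite !pairing_follower_reward !leader_value_visits /y.
  have split_bonus m' : \sum_i (x i + t * 1) * visits m' i =
      \sum_i x i * visits m' i + t * \sum_(i : {s : S | s \in Sd}) visits m' i.
    rewrite mulr_sumr -big_split /=; apply: eq_bigr => i _; ring.
  rewrite !split_bonus => le1 le2; rewrite -(ler_pM2l t0); lra.
have [s1 s10 s1P] := small_multiple (\sum_i q T i) gap.
pose s := Order.min d s1.
have s0 : 0 < s by rewrite lt_min d0.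
have [|c c0 ball] := dP s; first by rewrite s0 ge_min lexx.
have sC : s * \sum_i q T i < (C - \sum_i x i) / 2.
  by apply: s1P; rewrite s0 ge_min lexx orbT.
exists (fun i => y i + s * q T i), (e T).
  (* [y] certifies that [e T] is an optimal occupancy measure; the interior point is the one shifted
     further. *)
  exists y; split.
    split; [split=> //=|exact: eM|exact: Tbest].
    by move: sumy xC; lra.
  by move=> x' m' /max le; exact: le_trans leader.
split.
  split=> [i|].
    apply: addr_ge0 => //; apply: mulr_ge0; first exact: ltW.
    by apply: sumr_ge0 => a _; case: (eM T).
  by rewrite big_split /= -mulr_sumr; move: sumy sC; lra.
by exists c => // v v1; apply: best; exact: ball.
Qed.

Theorem theorem14 (R : realType) (S A : finType) (M : mdp R S A)
    (Sd : {set S}) (C : R) (hC : C != 0) :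
  (exists x : allocation R Sd, optimal_interior_point_allocation M C x) <->
  (0%:E < unused_budget_value M Sd C)%E.
Proof.
rewrite unused_budget_gt0; split.
  move=> [x [m [x1 [[_ mM _] max]] /(interior_unused_budget hC)]].
  by move=> [x' [adm br lt]]; exists x', m.
by move=> [x [m [opt lt]]]; exact: unused_budget_interior opt lt.
Qed.
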